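(* Let $1<p\le q<\infty$. Let $(X,\mu)$ be a measure space. Let $X=X_1\cup X_2\cup\cdots$ be a (countable, measurable) partition of $X$ and set $X^{(n)}:=X_1\cup\cdots\cup X_n$. Let $(b_n)_{n\ge1}$ and $(M_n)_{n\ge1}$ be sequences of weights, and set $M_0:=0$. Let $m$ be a measurable function on $X$ and define $$w_n:=\left(\int_{X_n}|m(x)|^{p'}\,\mathrm{d}\mu(x)\right)^{1/p'}.$$ Suppose that $w_n>0$ for all $n\ge1$ and set $\gamma_n:=b_n^{1/p+1/q'}/w_n$. If $0<\rho<\infty$ is such that $$\frac1q\,\frac{M_n(\gamma_n-\gamma_{n+1})}{b_n}+\frac1{q'}\,\frac{\gamma_n(M_n-M_{n-1})}{b_n}\ge\frac1\rho\qquad\text{for } n=1,2,3,\dots,$$ then, for every measurable function $f$ on $X$, $$\left(\sum_{n=1}^\infty b_n\left|\frac1{M_n}\int_{X^{(n)}}m(x)f(x)\,\mathrm{d}\mu(x)\right|^q\right)^{1/q}\le\rho\left(\sum_{n=1}^\infty b_n\int_{X_n}|f(x)|^p\,\mathrm{d}\mu(x)\right)^{1/p}.$$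
   Context: A sequence of weights is a sequence of positive real numbers. $p'$ and $q'$ are the Hölder conjugates of $p$ and $q$: $\frac1p+\frac1{p'}=1$, $\frac1q+\frac1{q'}=1$. Functions are complex-valued. If $w_n=\infty$, then $\gamma_n$ is read as $0$. The concluding inequality is understood to hold trivially when its right-hand side is $+\infty$ (when it is finite, Hölder's inequality makes the integrals on the left well defined). *)

(* Defs.v *)
From mathcomp Require Export all_boot all_order all_algebra.
From mathcomp Require Export all_classical all_reals all_analysis.
From mathcomp Require Export complex.
Export Order.TTheory GRing.Theory Num.Theory.
Export numFieldNormedType.Exports.

Set Implicit Arguments.
Unset Strict Implicit.
Unset Printing Implicit Defensive.

Local Open Scope classical_set_scope.
Local Open Scope ring_scope.

(* R-valued modulus; the generic norm `|z| of R[i] takes its values in R[i]. *)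
Definition cabs (R : realType) (z : R[i]) : R := ComplexField.Normc.normc z.

(* Borel measurability, for the usual topology of the complex plane. *)
Definition cmeasurable d (T : measurableType d) (R : realType)
    (f : T -> R[i]) : Prop :=
  measurable_fun [set: T] (f : T -> g_sigma_algebraType (@open (R[i] : numFieldType))).

(* Like Rintegral, this is meaningful when g is integrable over A, i.e. when
   both its real and imaginary parts are. *)
Definition cintegral d (T : measurableType d) (R : realType)
    (mu : {measure set T -> \bar R}) (A : set T) (g : T -> R[i]) : R[i] :=
  Complex (Rintegral mu A (fun x => complex.Re (g x)))
          (Rintegral mu A (fun x => complex.Im (g x))).

Definition cLnorm d (T : measurableType d) (R : realType)
    (mu : {measure set T -> \bar R}) (r : R) (A : set T) (g : T -> R[i]) :
    \bar R :=
  ((\int[mu]_(x in A) (cabs (g x) `^ r)%:E) `^ r^-1)%E.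

(* b^(1/p + 1/q') / w, read as 0 when w is infinite. *)
Definition gamma_of (R : realType) (p q' b : R) (w : \bar R) : R :=
  if w == +oo%E then 0 else b `^ (p^-1 + q'^-1) / fine w.

(* Main.v *)
Require Import Defs.
From mathcomp Require Import ring lra measurable_realfun.

Set Implicit Arguments.
Unset Strict Implicit.
Unset Printing Implicit Defensive.

Local Open Scope classical_set_scope.
Local Open Scope ring_scope.

(** Hoelder's inequality on each piece X_k reduces the theorem to a discrete
    Hardy inequality.  Write F_k for the L^p norm of f on X_k, put
    x_k := b_k^(1/p) F_k and a_k := w_k F_k.  Then the modulus of the integral
    of m f over X^(n) is at most A_n := a_1 + ... + a_n
    ([cabs_cintegral_mul_le]), and gamma_k is defined exactly so that
    gamma_k a_k = b_k^(1/q') x_k.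

    The discrete inequality bounds sum b_n c_n^q, where c_n := A_n / M_n.  Since
    a_n = M_n c_n - M_(n-1) c_(n-1), multiplying
    gamma_n a_n = b_n^(1/q') x_n by c_n^(q-1) and estimating the mixed product
    c_(n-1) c_n^(q-1) by Young's inequality leaves only the powers c_n^q and
    c_(n-1)^q ([weighted_hardy_step]).  After summation by parts the coefficient
    of c_n^q is
      (1/q) M_n (gamma_n - gamma_(n+1)) + (1/q') gamma_n (M_n - M_(n-1)),
    so the hypothesis on rho says that it is at least b_n / rho.  This gives
      sum b_n c_n^q <= rho sum b_n^(1/q') c_n^(q-1) x_n,
    and a second use of Young's inequality absorbs the right-hand side into
    sum b_n c_n^q <= rho^q sum x_n^q ([weighted_hardy_partial]).  Finally
    q >= p gives sum x_n^q <= (sum x_n^p)^(q/p) ([sum_powR_le]), and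
    sum x_n^p is the sum in the right-hand side of the theorem.

    The w_n are all finite: w_n = +oo would make gamma_n = 0, and the
    hypothesis on rho at n would then force gamma_(n+1) < 0. *)

(** * The discrete Hardy inequality *)

Lemma conj_exponentE (R : realFieldType) (q q' : R) :
  1 < q -> q^-1 + q'^-1 = 1 ->
  [/\ 0 < q', q'^-1 = 1 - q^-1 & (q - 1) * q' = q].
Proof.
move=> q_gt1 qq'; have q0 : 0 < q by exact: lt_trans q_gt1.
have q'E : q'^-1 = 1 - q^-1 by rewrite -qq' addrC addKr.
have q'0 : 0 < q' by rewrite -invr_gt0 q'E subr_gt0 invf_lt1.
split=> //; apply: (mulIf (invr_neq0 (lt0r_neq0 q'0))).
by rewrite mulfK ?gt_eqF// q'E mulrBr mulr1 mulfV ?gt_eqF.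
Qed.

(** It suffices to treat two summands y and S: as r - 1 >= 0,
    y y^(r-1) + S S^(r-1) <= (y + S) (y + S)^(r-1). *)
Lemma sum_powR_le (R : realType) (I : Type) (s : seq I) (P : pred I)
    (y : I -> R) (r : R) :
  1 <= r -> (forall i, P i -> 0 <= y i) ->
  \sum_(i <- s | P i) y i `^ r <= (\sum_(i <- s | P i) y i) `^ r.
Proof.
move=> r1 y0; have r0 : 0 < r by exact: lt_le_trans r1.
elim: s => [|i s IH]; first by rewrite !big_nil powR0 ?gt_eqF.
rewrite !big_cons; case: ifP => // /y0 yi0; set S := \sum_(j <- s | P j) y j.
have S0 : 0 <= S by exact: sumr_ge0.
apply: le_trans (lerD (lexx _) IH) _.
have rB1 : 0 <= r - 1 by rewrite subr_ge0.
rewrite -!(@mulr_powRB1 _ _ r)// ?addr_ge0// mulrDl lerD//.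
  by rewrite ler_wpM2l// ge0_ler_powR// ?nnegrE ?addr_ge0// lerDl.
by rewrite ler_wpM2l// ge0_ler_powR// ?nnegrE ?addr_ge0// lerDr.
Qed.

(** One step of the summation by parts.  Here c and e are consecutive averages
    c_(n-1) and c_n, K and L are M_(n-1) and M_n, and g and g1 are gamma_n and
    gamma_(n+1), so that L e - K c is the increment a_n.  Expanding the last
    product, the only term that is not a multiple of c^q or e^q is
    - g K c e^(q-1), which Young's inequality controls because
    e^(q-1) raised to q' is e^q. *)
Lemma weighted_hardy_step (R : realType) (q q' : R) (q_gt1 : 1 < q)
    (qq' : q^-1 + q'^-1 = 1) (g g1 K L bb rho c e : R) :
  0 < g -> 0 <= K -> 0 <= c -> 0 <= e ->
  rho^-1 * bb <= q^-1 * (L * (g - g1)) + q'^-1 * (g * (L - K)) ->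
  rho^-1 * bb * e `^ q + q^-1 * (g1 * L * e `^ q)
  <= q^-1 * (g * K * c `^ q) + g * (L * e - K * c) * e `^ (q - 1).
Proof.
move=> g0 K0 c0 e0 H; have q0 : 0 < q by exact: lt_trans q_gt1.
have [q'0 q'E qB1] := conj_exponentE q_gt1 qq'.
have Y : c * e `^ (q - 1) <= q^-1 * c `^ q + q'^-1 * e `^ q.
  have := @conjugate_powR _ c (e `^ (q - 1)) q q' c0 (powR_ge0 _ _) q0 q'0 qq'.
  by rewrite -powRrM qB1 ![_^-1 * _]mulrC.
have E : e * e `^ (q - 1) = e `^ q by rewrite mulr_powRB1.
have := ler_wpM2r (powR_ge0 e q) H.
have := ler_wpM2l (mulr_ge0 (ltW g0) K0) Y.
rewrite q'E -E; set t := e `^ (q - 1); set u := q^-1; set v := c `^ q => H1 H2.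
nra.
Qed.

(** The sums are finite because the proof bounds the left-hand side by a
    multiple (1 - 1/q) of itself plus another term, and then subtracts. *)
Lemma weighted_hardy_partial (R : realType) (q q' : R) (b M gamma x a : nat -> R)
    (rho : R) (N : nat) :
  1 < q -> q^-1 + q'^-1 = 1 -> 0 < rho ->
  (forall n, (1 <= n)%N -> 0 < b n) ->
  (forall n, (1 <= n)%N -> 0 < M n) -> M 0%N = 0 ->
  (forall n, (1 <= n)%N -> 0 < gamma n) ->
  (forall n, (1 <= n)%N ->
     q^-1 * (M n * (gamma n - gamma n.+1) / b n)
     + q'^-1 * (gamma n * (M n - M n.-1) / b n) >= rho^-1) ->
  (forall n, (1 <= n)%N -> 0 <= x n) -> (forall n, (1 <= n)%N -> 0 <= a n) ->
  (forall n, (1 <= n)%N -> gamma n * a n = b n `^ q'^-1 * x n) ->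
  \sum_(1 <= n < N.+1) b n * ((M n)^-1 * \sum_(1 <= k < n.+1) a k) `^ q
  <= rho `^ q * \sum_(1 <= n < N.+1) x n `^ q.
Proof.
move=> q1 qq' rho0 b0 M0 Mz g0 H x0 a0 ga.
have q0 : 0 < q by exact: lt_trans q1.
have [q'0 q'E qB1] := conj_exponentE q1 qq'.
pose A n := \sum_(1 <= k < n.+1) a k.
pose c n := (M n)^-1 * A n.
have M_ge0 n : 0 <= M n by case: n => [|n]; [rewrite Mz|exact/ltW/M0].
have c0 n : 0 <= c n.
  rewrite mulr_ge0 ?invr_ge0// /A big_nat sumr_ge0//.
  by move=> k /andP[/a0].
have McA n : M n * c n = A n.
  case: n => [|n]; first by rewrite Mz mul0r /A big_geq.
  by rewrite /c mulVKf// gt_eqF// M0.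
(* The boundary term at N + 1 is kept so that the induction closes; it is
   nonnegative and dropped afterwards. *)
have telescoped : rho^-1 * \sum_(1 <= n < N.+1) b n * c n `^ q
      + q^-1 * (gamma N.+1 * M N * c N `^ q)
    <= \sum_(1 <= n < N.+1) b n `^ q'^-1 * x n * c n `^ (q - 1).
  elim: N => [|N IH]; first by rewrite !big_geq// Mz ?(mulr0, mul0r) addr0.
  rewrite [X in rho^-1 * X]big_nat_recr//= [leRHS]big_nat_recr//= mulrDr mulrA.
  have bn0 := b0 N.+1 isT.
  have HN : rho^-1 * b N.+1 <= q^-1 * (M N.+1 * (gamma N.+1 - gamma N.+2))
      + q'^-1 * (gamma N.+1 * (M N.+1 - M N)).
    have := H N.+1 isT; rewrite !mulrA -mulrDl => /(ler_wpM2r (ltW bn0)).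
    by rewrite mulfVK ?gt_eqF//= !mulrA.
  have := weighted_hardy_step q1 qq' (g0 N.+1 isT) (M_ge0 N) (c0 N) (c0 N.+1)
    HN.
  have -> : M N.+1 * c N.+1 - M N * c N = a N.+1.
    by rewrite !McA /A big_nat_recr//= addrAC subrr add0r.
  rewrite -ga// => St.
  lra.
(* The factor rho is moved inside the product before Young is applied, which is
   where rho^q comes from. *)
have young n : (1 <= n)%N -> b n `^ q'^-1 * x n * c n `^ (q - 1)
    <= rho^-1 * (q'^-1 * (b n * c n `^ q) + q^-1 * (rho `^ q * x n `^ q)).
  move=> n1; rewrite ler_pdivlMl//.
  have U : (b n `^ q'^-1 * c n `^ (q - 1)) `^ q' = b n * c n `^ q.
    rewrite (powRM _ (powR_ge0 _ _) (powR_ge0 _ _)) -!powRrM qB1.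
    by rewrite mulVf ?gt_eqF// powRr1// ltW// b0.
  have V : (rho * x n) `^ q = rho `^ q * x n `^ q by rewrite powRM ?x0// ltW.
  have := @conjugate_powR _ (b n `^ q'^-1 * c n `^ (q - 1)) (rho * x n) q' q
    (mulr_ge0 (powR_ge0 _ _) (powR_ge0 _ _)) (mulr_ge0 (ltW rho0) (x0 _ n1))
    q'0 q0.
  rewrite addrC qq' U V => /(_ erefl).
  rewrite [_ / q']mulrC [_ / q]mulrC; apply: le_trans.
  by rewrite le_eqVlt; apply/orP; left; apply/eqP; ring.
set S := (X in X <= _); set V := \sum_(1 <= n < N.+1) x n `^ q.
have : rho^-1 * S <= rho^-1 * ((1 - q^-1) * S + q^-1 * (rho `^ q * V)).
  have W0 : 0 <= q^-1 * (gamma N.+1 * M N * c N `^ q).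
    by rewrite !mulr_ge0 ?invr_ge0 ?powR_ge0// ltW// g0.
  apply: (le_trans _ (le_trans telescoped _)); first by rewrite lerDl.
  rewrite (le_trans (ler_sum_nat (fun n nN => young n (proj1 (andP nN)))))//.
  by rewrite -mulr_sumr big_split/= -!mulr_sumr q'E.
rewrite ler_pM2l ?invr_gt0// mulrBl mul1r => h.
have : q^-1 * S <= q^-1 * (rho `^ q * V) by lra.
by rewrite ler_pM2l ?invr_gt0.
Qed.

(** * Complex integrals and Hoelder's inequality on a piece *)

(** Only the Borel sets of the complex plane are available on the side of f, so
    real measurability of Re f, Im f and |f| comes from the continuity of the
    outer function; being 1-Lipschitz is what these three have in common. *)
Lemma cmeasurable_comp_lipschitz d (T : measurableType d) (R : realType)
    (f : T -> R[i]) (h : R[i] -> R) :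
  (forall y z, `|h y - h z| <= cabs (y - z)) ->
  cmeasurable f -> measurable_fun setT (h \o f).
Proof.
move=> h_lip mf; apply: (measurability _ (RGenOpens.measurableE R)).
move=> _ [_ [a [b ->]] <-]; rewrite setTI comp_preimage.
have h_cont : continuous (h : (R[i] : numFieldType) -> R).
  move=> z; have FF := nbhs_filter (z : (R[i] : numFieldType)).
  apply/(@cvgrPdist_lt R R^o _ _ FF) => e e0.
  apply/nbhs_ballP; exists (real_complex R e) => /=; first by rewrite ltcR.
  move=> y; rewrite -ball_normE /= normc_def ltcR => zy.
  by apply: le_lt_trans zy; apply: le_trans (h_lip _ _) _; case: (z - y).
have oU : open (h @^-1` `]a, b[ : set (R[i] : numFieldType)).
  by apply: open_comp => [z _|]; [exact: h_cont|exact: interval_open].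
rewrite -[X in measurable X]setTI; apply: mf => //.
exact: sub_sigma_algebra.
Qed.

Lemma normr_Re_le_cabs (R : realType) (z : R[i]) : `|complex.Re z| <= cabs z.
Proof.
case: z => a b; rewrite /cabs /= -sqrtr_sqr ler_wsqrtr// lerDl sqr_ge0//.
Qed.

Lemma normr_Im_le_cabs (R : realType) (z : R[i]) : `|complex.Im z| <= cabs z.
Proof.
case: z => a b; rewrite /cabs /= -sqrtr_sqr ler_wsqrtr// lerDr sqr_ge0//.
Qed.

Lemma cabs_ge0 (R : realType) (z : R[i]) : 0 <= cabs z.
Proof. by case: z => a b; exact: sqrtr_ge0. Qed.

Lemma cabsM (R : realType) (y z : R[i]) : cabs (y * z) = cabs y * cabs z.
Proof. exact: ComplexField.Normc.normcM. Qed.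

Lemma cabs_real_complex (R : realType) (r : R) : cabs (real_complex R r) = `|r|.
Proof. by rewrite /cabs /= expr0n addr0 sqrtr_sqr. Qed.

Lemma cmeasurable_Re d (T : measurableType d) (R : realType) (f : T -> R[i]) :
  cmeasurable f -> measurable_fun setT (fun x => complex.Re (f x)).
Proof.
apply: cmeasurable_comp_lipschitz => y z.
by apply: le_trans (normr_Re_le_cabs (y - z)); case: y z => [a b] [].
Qed.

Lemma cmeasurable_Im d (T : measurableType d) (R : realType) (f : T -> R[i]) :
  cmeasurable f -> measurable_fun setT (fun x => complex.Im (f x)).
Proof.
apply: cmeasurable_comp_lipschitz => y z.
by apply: le_trans (normr_Im_le_cabs (y - z)); case: y z => [a b] [].
Qed.

Lemma cmeasurable_cabs d (T : measurableType d) (R : realType) (f : T -> R[i]) :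
  cmeasurable f -> measurable_fun setT (fun x => cabs (f x)).
Proof.
apply: cmeasurable_comp_lipschitz => y z.
have tri (u v : R[i]) : cabs u - cabs v <= cabs (u - v).
  by rewrite lerBlDr -{1}(subrK v u); exact: le_normcD.
rewrite ler_norml tri andbT lerNl opprB.
by apply: le_trans (tri z y) _; rewrite -opprB /cabs normcN.
Qed.

(** With integral a + ib of modulus s, s^2 is the integral of a Re g + b Im g,
    which is pointwise at most s |g| by Cauchy-Schwarz; divide by s. *)
Lemma cabs_cintegral_le d (T : measurableType d) (R : realType)
    (mu : {measure set T -> \bar R}) (A : set T) (g : T -> R[i]) :
  measurable A ->
  measurable_fun A (fun x => complex.Re (g x)) ->
  measurable_fun A (fun x => complex.Im (g x)) ->
  measurable_fun A (fun x => cabs (g x)) ->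
  (\int[mu]_(x in A) (cabs (g x))%:E < +oo)%E ->
  ((cabs (cintegral mu A g))%:E <= \int[mu]_(x in A) (cabs (g x))%:E)%E.
Proof.
move=> mA mRe mIm mN Noo.
have iN : mu.-integrable A (EFin \o (fun x => cabs (g x))).
  apply/integrableP; split; first exact/measurable_EFinP.
  by under eq_integral do rewrite /= ger0_norm ?cabs_ge0//.
have iRe : mu.-integrable A (EFin \o (fun x => complex.Re (g x))).
  apply: le_integrable iN => //; first exact/measurable_EFinP.
  by move=> x _; rewrite /= lee_fin (ger0_norm (cabs_ge0 _)) normr_Re_le_cabs.
have iIm : mu.-integrable A (EFin \o (fun x => complex.Im (g x))).
  apply: le_integrable iN => //; first exact/measurable_EFinP.
  by move=> x _; rewrite /= lee_fin (ger0_norm (cabs_ge0 _)) normr_Im_le_cabs.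
have iZ (u : T -> R) k : mu.-integrable A (EFin \o u) ->
    mu.-integrable A (EFin \o (fun x => k * u x)).
  by move=> iu; have := integrableZl mA k iu; apply: eq_integrable.
rewrite /cintegral.
set a := Rintegral _ _ _; set b := Rintegral _ _ _; set s := cabs _.
have -> : (\int[mu]_(x in A) (cabs (g x))%:E)%E
    = (Rintegral mu A (fun x => cabs (g x)))%:E.
  by rewrite /Rintegral fineK// (integrable_fin_num mA iN).
rewrite lee_fin.
have s_ge0 : 0 <= s by exact: cabs_ge0.
have sE : s ^+ 2 = a ^+ 2 + b ^+ 2 by rewrite sqr_sqrtr// addr_ge0 ?sqr_ge0.
have cs z : a * complex.Re z + b * complex.Im z <= s * cabs z.
  apply: le_trans (ler_norm _) _.
  rewrite -(ler_pXn2r (ltn0Sn 1)) ?nnegrE ?mulr_ge0 ?cabs_ge0//.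
  case: z => x y /=; rewrite real_normK ?num_real// exprMn
    sE sqr_sqrtr ?addr_ge0 ?sqr_ge0//.
  have := sqr_ge0 (a * y - b * x); nra.
have [s0|s_neq0] := eqVneq s 0.
  by rewrite s0; apply: Rintegral_ge0 => x _; exact: cabs_ge0.
rewrite -(@ler_pM2l _ s) ?lt0r ?s_neq0// -expr2 sE !expr2.
rewrite {2}/a {2}/b -!RintegralZl// -RintegralD ?iZ//.
apply: le_Rintegral => //; last exact: iZ.
by have := integrableD mA (iZ _ a iRe) (iZ _ b iIm); apply: eq_integrable.
Qed.

(** Hoelder's inequality on the whole space, applied to the extensions of u
    and v by 0 outside D. *)
Lemma hoelder_set d (T : measurableType d) (R : realType)
    (mu : {measure set T -> \bar R}) (D : set T) (u v : T -> R) (p q : R) :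
  measurable D -> measurable_fun D u -> measurable_fun D v ->
  (forall x, 0 <= u x) -> (forall x, 0 <= v x) ->
  0 < p -> 0 < q -> p^-1 + q^-1 = 1 ->
  (\int[mu]_(x in D) (u x * v x)%:E <=
   (\int[mu]_(x in D) (u x `^ p)%:E) `^ p^-1 *
   (\int[mu]_(x in D) (v x `^ q)%:E) `^ q^-1)%E.
Proof.
move=> mD mu_ mv u0 v0 p0 q0 pq.
have := @hoelder _ _ _ mu (u \_ D) (v \_ D) p q.
rewrite Lnorm1 unlock !(integral_mkcond D).
move=> /(_ _ _ p0 q0 pq).
have -> : (\int[mu]_x `|((u \_ D) \* (v \_ D)) x|%:E)%E =
   (\int[mu]_x ((fun x => (u x * v x)%:E) \_ D) x)%E.
  apply: eq_integral => x _; rewrite /= !patchE; case: ifP => _; last first.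
    by rewrite mulr0 normr0.
  by rewrite ger0_norm ?mulr_ge0.
have pw (h : T -> R) r : (forall x, 0 <= h x) -> 0 < r ->
   (\int[mu]_x (`|((h \_ D) x)%:E| `^ r))%E =
   (\int[mu]_x ((fun x => (h x `^ r)%:E) \_ D) x)%E.
  move=> h0 r0; apply: eq_integral => x _; rewrite /= !patchE; case: ifP => _.
    by rewrite ger0_norm.
  by rewrite normr0 powR0 ?gt_eqF.
rewrite !pw//; apply.
- exact/(measurable_restrictT _ mD).
- exact/(measurable_restrictT _ mD).
Qed.

(** The finiteness of the sum of products of norms is what makes m f integrable
    over the union; without it [cintegral] would carry no information. *)
Lemma cabs_cintegral_mul_le d (T : measurableType d) (R : realType)
    (mu : {measure set T -> \bar R}) (I : eqType) (s : seq I) (F : I -> set T)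
    (p q : R) (m f : T -> R[i]) :
  (forall i, measurable (F i)) -> uniq s -> trivIset [set` s] F ->
  0 < p -> 0 < q -> p^-1 + q^-1 = 1 -> cmeasurable m -> cmeasurable f ->
  (\sum_(i <- s) cLnorm mu p (F i) m * cLnorm mu q (F i) f < +oo)%E ->
  ((cabs (cintegral mu (\big[setU/set0]_(i <- s) F i) (fun x => m x * f x)%R))%:E
   <= \sum_(i <- s) cLnorm mu p (F i) m * cLnorm mu q (F i) f)%E.
Proof.
move=> mF us tF p0 q0 pq mm mf foo.
have mD : measurable (\big[setU/set0]_(i <- s) F i) by exact: bigsetU_measurable.
have mabs : measurable_fun setT (fun x => cabs (m x * f x)).
  under eq_fun do rewrite cabsM.
  by apply: measurable_funM; exact: cmeasurable_cabs.
have mRe : measurable_fun setT (fun x => complex.Re (m x * f x)).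
  rewrite (_ : (fun x => _) = (fun x => complex.Re (m x) * complex.Re (f x))
      \- (fun x => complex.Im (m x) * complex.Im (f x))); last first.
    by apply/funext => x /=; case: (m x) (f x) => [? ?] [].
  by apply: measurable_funB; apply: measurable_funM;
    by [exact: cmeasurable_Re|exact: cmeasurable_Im].
have mIm : measurable_fun setT (fun x => complex.Im (m x * f x)).
  rewrite (_ : (fun x => _) = (fun x => complex.Re (m x) * complex.Im (f x))
      \+ (fun x => complex.Im (m x) * complex.Re (f x))); last first.
    by apply/funext => x /=; case: (m x) (f x) => [? ?] [].
  by apply: measurable_funD; apply: measurable_funM;
    by [exact: cmeasurable_Re|exact: cmeasurable_Im].
have H : (\int[mu]_(x in \big[setU/set0]_(i <- s) F i) (cabs (m x * f x))%:E
    <= \sum_(i <- s) cLnorm mu p (F i) m * cLnorm mu q (F i) f)%E.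
  rewrite ge0_integral_bigsetU//; last 2 first.
  - exact/measurable_EFinP/(measurable_funS measurableT).
  - by move=> x _; rewrite lee_fin cabs_ge0.
  apply: lee_sum => i _; under eq_integral do rewrite cabsM.
  apply: hoelder_set => //; try (by move=> x; exact: cabs_ge0);
    by apply: (measurable_funS measurableT) => //; exact: cmeasurable_cabs.
apply: (le_trans _ H); apply: cabs_cintegral_le => //;
  try exact: (measurable_funS measurableT).
exact: le_lt_trans H foo.
Qed.

(** * The weighted Hardy inequality on a partitioned measure space *)

Theorem theorem3 (R : realType) (d : measure_display) (T : measurableType d)
  (mu : {measure set T -> \bar R})
  (p q p' q' : R)
  (p_gt1 : 1 < p) (p_le_q : p <= q)
  (pp' : p^-1 + p'^-1 = 1) (qq' : q^-1 + q'^-1 = 1)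
  (X : nat -> set T)
  (mX : forall n, (1 <= n)%N -> measurable (X n))
  (X_disj : trivIset [set n | (1 <= n)%N] X)
  (X_cover : \bigcup_(n in [set n | (1 <= n)%N]) X n = [set: T])
  (b M : nat -> R)
  (b_gt0 : forall n, (1 <= n)%N -> 0 < b n)
  (M_gt0 : forall n, (1 <= n)%N -> 0 < M n)
  (M0 : M 0%N = 0)
  (m : T -> R[i]) (mm : cmeasurable m)
  (w : nat -> \bar R)
  (w_def : forall n, (1 <= n)%N -> w n = cLnorm mu p' (X n) m)
  (w_gt0 : forall n, (1 <= n)%N -> (0 < w n)%E)
  (gamma : nat -> R)
  (gamma_def : forall n, (1 <= n)%N -> gamma n = gamma_of p q' (b n) (w n))
  (rho : R) (rho_gt0 : 0 < rho)
  (Hrho : forall n, (1 <= n)%N ->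
     q^-1 * (M n * (gamma n - gamma n.+1) / b n)
     + q'^-1 * (gamma n * (M n - M n.-1) / b n) >= rho^-1)
  (f : T -> R[i]) (mf : cmeasurable f) :
  ((\sum_(1 <= n <oo)
      (b n * cabs (real_complex R (M n)^-1
                   * cintegral mu (\big[setU/set0]_(1 <= k < n.+1) X k)
                       (fun x => m x * f x)%R) `^ q)%:E) `^ q^-1
   <= rho%:E *
      (\sum_(1 <= n <oo)
         (b n)%:E * \int[mu]_(x in X n) (cabs (f x) `^ p)%:E) `^ p^-1)%E.
Proof.
have p0 : 0 < p by exact: lt_trans p_gt1.
have q_gt1 : 1 < q by exact: lt_le_trans p_le_q.
have q0 : 0 < q by exact: lt_trans q_gt1.
have [p'0 _ _] := conj_exponentE p_gt1 pp'.
have gamma_ge0 n : (1 <= n)%N -> 0 <= gamma n.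
  move=> n1; rewrite gamma_def// /gamma_of; case: ifP => // _.
  by rewrite divr_ge0 ?powR_ge0// fine_ge0// ltW// w_gt0.
(* If gamma_n = 0, the left-hand side of the hypothesis at n is
   - M_n gamma_(n+1) / (q b_n) <= 0 < 1 / rho. *)
have gamma_neq0 n : (1 <= n)%N -> gamma n != 0.
  move=> n1; apply/eqP => gn0; have := Hrho n n1; rewrite gn0 mul0r mul0r mulr0
    addr0 sub0r.
  apply/negP; rewrite -ltNge (@le_lt_trans _ _ 0) ?invr_gt0//.
  rewrite pmulr_rle0 ?invr_gt0// pmulr_lle0 ?invr_gt0 ?b_gt0//.
  by rewrite pmulr_rle0 ?M_gt0// oppr_le0 gamma_ge0.
have gamma_gt0 n : (1 <= n)%N -> 0 < gamma n.
  by move=> n1; rewrite lt0r gamma_neq0// gamma_ge0.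
have w_neqoo n : (1 <= n)%N -> w n != +oo%E.
  move=> n1; apply: contra (gamma_neq0 n n1) => woo.
  by rewrite gamma_def// /gamma_of woo.
have w_fin n : (1 <= n)%N -> w n = (fine (w n))%:E.
  by move=> n1; rewrite fineK// gt0_fin_numE ?w_gt0// ltey w_neqoo.
have fw_gt0 n : (1 <= n)%N -> 0 < fine (w n).
  by move=> n1; rewrite -lte_fin -w_fin// w_gt0.
pose J n : \bar R := (\int[mu]_(x in X n) (cabs (f x) `^ p)%:E)%E.
have J_ge0 n : (0 <= J n)%E.
  by apply: integral_ge0 => x _; rewrite lee_fin powR_ge0.
set Z : \bar R := (\sum_(1 <= n <oo) (b n)%:E * J n)%E.
have bJ_ge0 n : (1 <= n)%N -> true -> (0 <= (b n)%:E * J n)%E.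
  by move=> n1 _; rewrite mule_ge0// lee_fin ltW// b_gt0.
have Z_ge0 : (0 <= Z)%E by exact: nneseries_ge0.
(* An infinite right-hand side leaves nothing to prove; otherwise every J n
   with n >= 1 is finite. *)
have [->|Z_neqoo] := eqVneq Z +oo%E.
  by rewrite poweRyr ?invr_neq0 ?gt_eqF// gt0_muley ?leey// lte_fin.
have Z_fin : Z = (fine Z)%:E by rewrite fineK// ge0_fin_numE// ltey.
have partialZ N : (\sum_(1 <= n < N) (b n)%:E * J n <= Z)%E.
  exact: nneseries_lim_ge.
have J_fin n : (1 <= n)%N -> J n = (fine (J n))%:E.
  move=> n1; rewrite fineK// ge0_fin_numE//.
  rewrite -(@lte_pmul2l _ (b n)%:E) ?lte_fin ?b_gt0//.
  rewrite gt0_muley ?lte_fin ?b_gt0//.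
  apply: le_lt_trans (_ : Z < +oo)%E; last by rewrite ltey.
  apply: le_trans (partialZ n.+1); rewrite big_nat_recr//= leeDr// big_nat.
  by apply: sume_ge0 => k /andP[k1 _]; exact: bJ_ge0.
pose y n := b n * fine (J n).
have y_ge0 n : (1 <= n)%N -> 0 <= y n.
  by move=> n1; rewrite mulr_ge0 ?fine_ge0// ltW// b_gt0.
pose x n := y n `^ p^-1.
pose a n := fine (w n) * fine (J n) `^ p^-1.
have a_ge0 n : (1 <= n)%N -> 0 <= a n.
  by move=> n1; rewrite mulr_ge0 ?powR_ge0// ltW// fw_gt0.
have gamma_a n : (1 <= n)%N -> gamma n * a n = b n `^ q'^-1 * x n.
  move=> n1; rewrite gamma_def// /gamma_of (negbTE (w_neqoo n n1)) /a mulrA.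
  rewrite divfK ?gt_eqF ?fw_gt0// /x /y powRM ?fine_ge0 ?(ltW (b_gt0 n n1))//.
  rewrite powRD; first by ring.
  by rewrite (gt_eqF (b_gt0 n n1)) implybT.
have cint_le n : (1 <= n)%N ->
    cabs (cintegral mu (\big[setU/set0]_(1 <= k < n.+1) X k) (fun t => m t * f t))
    <= \sum_(1 <= k < n.+1) a k.
  move=> n1; rewrite -lee_fin -sumEFin !big_add1 /=.
  (* Shifting the index to k.+1 avoids X 0, about which nothing is assumed. *)
  have E k : (a k.+1)%:E = (cLnorm mu p' (X k.+1) m * cLnorm mu p (X k.+1) f)%E.
    by rewrite -w_def// /cLnorm -/(J _) w_fin// J_fin// poweR_EFin.
  under [leRHS]eq_bigr do rewrite E.
  apply: cabs_cintegral_mul_le => //; last 1 first.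
  - by under eq_bigr do rewrite -E; rewrite sumEFin ltry.
  - by move=> k; exact: mX.
  - exact: iota_uniq.
  - by move=> i j _ _ ij; apply: succn_inj; exact: X_disj.
  - by rewrite addrC.
have term_le n : (1 <= n)%N ->
    b n * cabs (real_complex R (M n)^-1
      * cintegral mu (\big[setU/set0]_(1 <= k < n.+1) X k) (fun t => m t * f t)) `^ q
    <= b n * ((M n)^-1 * \sum_(1 <= k < n.+1) a k) `^ q.
  move=> n1; have Mn := M_gt0 n n1.
  rewrite ler_wpM2l ?(ltW (b_gt0 n n1))// ge0_ler_powR ?(ltW q0) ?nnegrE ?cabs_ge0//.
    by rewrite mulr_ge0 ?invr_ge0 ?(ltW Mn)// big_nat sumr_ge0// => k /andP[/a_ge0].
  by rewrite cabsM cabs_real_complex gtr0_norm ?invr_gt0//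
    ler_pM2l ?invr_gt0 ?cint_le.
have x_sum N : \sum_(1 <= n < N) x n `^ q <= fine Z `^ (q / p).
  have -> : \sum_(1 <= n < N) x n `^ q = \sum_(1 <= n < N) y n `^ (q / p).
    by apply: eq_bigr => n _; rewrite /x -powRrM mulrC.
  have y0 n : (1 <= n < N)%N -> 0 <= y n by move=> /andP[/y_ge0].
  rewrite big_nat; apply: le_trans (sum_powR_le _ _ y0) _.
    by rewrite ler_pdivlMr// mul1r.
  rewrite -big_nat ge0_ler_powR ?nnegrE ?divr_ge0 ?(ltW p0) ?(ltW q0) ?fine_ge0//.
    by rewrite big_nat sumr_ge0.
  rewrite -lee_fin -Z_fin -sumEFin; apply: le_trans (partialZ N).
  rewrite le_eqVlt; apply/orP; left; apply/eqP; apply: eq_big_nat => n /andP[n1 _].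
  by rewrite EFinM -J_fin.
set L := (X in (X `^ _ <= _)%E).
have L_le : (L <= ((rho * fine Z `^ p^-1) `^ q)%:E)%E.
  rewrite /L; apply: lime_le.
    apply: is_cvg_nneseries => n n1 _.
    by rewrite lee_fin mulr_ge0 ?powR_ge0// ltW// b_gt0.
  apply: nearW => -[|N]; first by rewrite big_geq// lee_fin powR_ge0.
  rewrite sumEFin lee_fin powRM ?powR_ge0 ?(ltW rho_gt0)// -powRrM [_ * q]mulrC.
  apply: (@le_trans _ _ (\sum_(1 <= n < N.+1)
      b n * ((M n)^-1 * \sum_(1 <= k < n.+1) a k) `^ q)).
    by apply: ler_sum_nat => n /andP[n1 _]; exact: term_le.
  apply: le_trans (weighted_hardy_partial N q_gt1 qq' rho_gt0 b_gt0 M_gt0 M0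
    gamma_gt0 Hrho (fun n _ => powR_ge0 _ _) a_ge0 gamma_a) _.
  by rewrite ler_wpM2l ?powR_ge0// x_sum.
have L_ge0 : (0 <= L)%E.
  apply: nneseries_ge0 => n n1 _.
  by rewrite lee_fin mulr_ge0 ?powR_ge0// ltW// b_gt0.
apply: (@le_trans _ _ ((((rho * fine Z `^ p^-1) `^ q)%:E) `^ q^-1)%E).
  by apply: gt0_ler_poweR L_le; rewrite ?invr_ge0 ?(ltW q0)// in_itv/=
    ?L_ge0 ?leey// lee_fin powR_ge0.
rewrite poweR_EFin -powRrM mulfV ?gt_eqF// powRr1 ?mulr_ge0 ?powR_ge0 ?(ltW rho_gt0)//.
by rewrite Z_fin poweR_EFin -EFinM.
Qed.
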